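(* Let $i\ge 0$ and let $S$ be a finite $(i-1)$-acyclic CW-complex with $n$ cells of dimension $i-1$ and $m$ cells of dimension $i$, and let $\partial:=\partial_i\in\mathbb{Z}^{n\times m}$ be its $i$-th cellular boundary matrix (with respect to chosen orientations of the cells). Then $$\operatorname{pdet}(\partial\partial^t)=\tau_{i-1}(S)\cdot\tau_i(S).$$ Moreover, let $\mathbf{x}=(x_1,\dots,x_n)$ and $\mathbf{y}=(y_1,\dots,y_m)$ be indeterminates indexing the $(i-1)$-cells and $i$-cells respectively, $X=\operatorname{diag}(\mathbf{x})$, $Y=\operatorname{diag}(\mathbf{y})$ and $L=X^{1/2}\partial Y\partial^tX^{1/2}$. Then $$\operatorname{pdet}(L)=\mathbf{x}^{[n]}\cdot\tau_{i-1}(S,\mathbf{x}^{-1})\cdot\tau_i(S,\mathbf{y}),$$ where $\mathbf{x}^{[n]}=x_1\cdots x_n$ and $\tau_{i-1}(S,\mathbf{x}^{-1})$ is obtained from $\tau_{i-1}(S,\mathbf{x})$ by substituting $x_j\mapsto x_j^{-1}$.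
   Context: CW-complexes use the augmented integral cellular chain complex $\cdots\to C_i(S)\xrightarrow{\partial_i}C_{i-1}(S)\to\cdots\to C_0(S)\xrightarrow{\partial_0}C_{-1}(S)=\mathbb{Z}\to0$ (one $(-1)$-dimensional empty cell), and $\tilde H_j(S)=\ker\partial_j/\operatorname{im}\partial_{j+1}$ with $\mathbb{Z}$ coefficients. $S^{(i)}$ is the $i$-skeleton. $S$ is $(i-1)$-acyclic if $\tilde H_j(S)=0$ for $-1\le j\le i-1$. For such $S$, a subcomplex $T$ is an $i$-tree if $S^{(i-1)}\subseteq T\subseteq S^{(i)}$ and any two (equivalently all three) of: (i) $\tilde H_i(T)=0$; (ii) $\tilde H_{i-1}(T)$ is finite; (iii) the number of $i$-cells of $T$ equals the rank of $\partial_i$. The torsion tree enumerator is $\tau_i(S)=\sum_{i\text{-trees }T}|\tilde H_{i-1}(T)|^2$, and with variables $\mathbf{x}$ indexing the $i$-cells, the weighted enumerator is $\tau_i(S,\mathbf{x})=\sum_{i\text{-trees }T}\mathbf{x}^T|\tilde H_{i-1}(T)|^2$, where $\mathbf{x}^T$ is the product of the variables of the $i$-cells of $T$. For a square matrix $M$ of rank $s$ over an integral domain, $\operatorname{pdet}(M)=\sum_{|I|=s}\det M_{I,I}$ (sum of principal $s\times s$ minors). *)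

(* Defs.v *)
From HB Require Import structures.
From mathcomp Require Import all_boot all_order all_algebra.
From mathcomp Require mpoly.

Set Implicit Arguments.
Unset Strict Implicit.
Unset Printing Implicit Defensive.

Import Order.TTheory GRing.Theory Num.Theory.
Local Open Scope ring_scope.

(* [mpoly] is imported only inside this module because its notations clash
   with those of the analysis library used below. *)
Module Indeterminates.
Import mpoly.

(* The field Q(X_0, ..., X_(k-1)), as the fraction field of Z[X]. *)
Definition ratfun (k : nat) : fieldType := {fraction {mpoly int[k]}}.

Definition indet (k : nat) (j : 'I_k) : ratfun k :=
  @FracField.tofrac {mpoly int[k]} 'X_j.

End Indeterminates.

Notation ratfun := Indeterminates.ratfun.
Notation indet := Indeterminates.indet.

From mathcomp Require Import finmap all_classical reals topology normedtype trigo.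
Import numFieldNormedType.Exports.
Local Open Scope classical_set_scope.

Section Pseudodeterminant.
Variable A : idomainType.

Definition rank_dom (p q : nat) (M : 'M[A]_(p, q)) : nat :=
  \rank (map_mx (@FracField.tofrac A) M).

Definition pdet (p : nat) (M : 'M[A]_p) : A :=
  \sum_(I : {set 'I_p} | #|I| == rank_dom M)
    \det (mxsub (@enum_val _ (mem I)) (@enum_val _ (mem I)) M).

End Pseudodeterminant.

(* Row vectors carry the product topology; the library norm on them is the sup
   norm, so the Euclidean one is written out. *)
Section Spheres.
Variable R : realType.

Definition sqnorm (k : nat) (x : 'rV[R]_k) : R := \sum_j x 0 j ^+ 2.

Definition disc (k : nat) : set 'rV[R]_k := [set x | sqnorm x <= 1].
Definition open_disc (k : nat) : set 'rV[R]_k := [set x | sqnorm x < 1].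

(* The unit sphere of R^k, of dimension k - 1; it is empty for k = 0. *)
Definition sphere (k : nat) : set 'rV[R]_k := [set x | sqnorm x = 1].

Local Arguments sphere k _ : clear implicits.

(* [pole] is the base point of the sphere of dimension k, and [pinch] induces
   a homeomorphism from disc k / sphere k onto that sphere, sending the class
   of sphere k to [pole]. *)
Definition pole (k : nat) : 'rV[R]_k.+1 := row_mx (1%:M : 'rV[R]_1) 0.

Definition pinch (k : nat) (y : 'rV[R]_k) : 'rV[R]_k.+1 :=
  row_mx ((2 * sqnorm y - 1)%:M : 'rV[R]_1)
         ((2 * Num.sqrt (1 - sqnorm y)) *: y).

Definition sphere_homotopic (k : nat) (f g : 'rV[R]_k -> 'rV[R]_k) : Prop :=
  exists H : R * 'rV[R]_k -> 'rV[R]_k,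
    [/\ {within `[0, 1]%classic `*` sphere k, continuous H},
        forall t x, t \in `[0, 1] -> sphere k x -> sphere k (H (t, x)),
        forall x, sphere k x -> H (0, x) = f x &
        forall x, sphere k x -> H (1, x) = g x].

(* The iterated suspension of z |-> z ^ d on the unit circle, written in polar
   coordinates (r, t) of the first two coordinates. *)
Definition winding (k : nat) (d : int) (g : 'rV[R]_k.+2 -> 'rV[R]_k.+2) : Prop :=
  forall (x : 'rV[R]_k.+2) (r t : R), 0 <= r ->
    x 0 0 = r * cos t -> x 0 1 = r * sin t ->
    g x = \row_j (if j == 0 then r * cos (d%:~R * t)
                  else if j == 1 then r * sin (d%:~R * t) else x 0 j).

(* The degree of a self-map f of the sphere of dimension k.  For k > 0 it is
   the class of f in [S^k, S^k] = Z; for k = 0 it is the effect of f on the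
   reduced homology of {1, -1}, i.e. (f 1 - f (-1)) / 2. *)
Definition has_degree (k : nat) :
    ('rV[R]_k.+1 -> 'rV[R]_k.+1) -> int -> Prop :=
  match k with
  | 0 => fun f d =>
      (f (const_mx 1)) 0 0 - (f (const_mx (- 1))) 0 0 = 2 * d%:~R
  | _.+1 => fun f d => exists2 g, winding d g & sphere_homotopic f g
  end.

End Spheres.

Arguments disc {R} k _.
Arguments open_disc {R} k _.
Arguments sphere {R} k _.
Arguments pole {R} k.

(* Finite CW-complexes, given by characteristic maps, of which only the
   restriction to the closed disc matters.  For finitely many cells the closure
   finiteness and weak topology axioms are automatic, and since the space is
   Hausdorff each characteristic map is a homeomorphism from the open disc onto
   the open cell.  The characteristic maps orient the cells. *)
Record finCW (R : realType) := FinCW {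
  cw_space : topologicalType;
  cw_cell : finType;
  cw_dim : cw_cell -> nat;
  cw_char : forall c : cw_cell, 'rV[R]_(cw_dim c) -> cw_space;
  cw_hausdorff : hausdorff_space cw_space;
  cw_continuous : forall c, {within disc (cw_dim c), continuous (@cw_char c)};
  cw_inj : forall c, {in open_disc (cw_dim c) &, injective (@cw_char c)};
  cw_partition : forall p : cw_space,
        exists! c, (@cw_char c @` open_disc (cw_dim c)) p;
  cw_attach : forall c x, sphere (cw_dim c) x -> exists2 b, (cw_dim b < cw_dim c)%N &
        (@cw_char b @` open_disc (cw_dim b)) (@cw_char c x)
}.

Section Cells.
Variables (R : realType) (S : finCW R).

Definition open_cell (c : cw_cell S) : set (cw_space S) :=
  @cw_char R S c @` open_disc (cw_dim c).

(* The cells together with the empty cell [None], of dimension -1. *)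
Definition acell : finType := option (cw_cell S).

Definition adim (c : acell) : int :=
  if c is Some c' then (cw_dim c')%:Z else - 1.

Definition cells (j : int) : {set acell} := [set c | adim c == j]%SET.

Definition skeleton (j : int) : {set acell} := [set c | adim c <= j]%SET.

(* A subcomplex contains the closure of each of its cells, the empty cell
   counting as a face of every cell.  The void complex, without even the empty
   cell, is allowed: it is the unique (-1)-tree. *)
Definition subcomplex (T : {set acell}) : Prop :=
  forall c : cw_cell S, Some c \in T ->
    None \in T /\
    @cw_char R S c @` disc (cw_dim c) `<=`
      \bigcup_(b in [set b | Some b \in T]) open_cell b.

(* The collapse X^(k) -> X^(k) / (X^(k) - e_b) = S^k, for k = dim b. *)
Definition collapse (b : cw_cell S) (p : cw_space S) : 'rV[R]_(cw_dim b).+1 :=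
  if pselect (open_cell b p) is left h then pinch (s2val (cid2 h)) else pole _.

(* The attaching map of c followed by the collapse onto b. *)
Definition attach (b c : cw_cell S) (e : cw_dim c = (cw_dim b).+1)
    (x : 'rV[R]_(cw_dim b).+1) : 'rV[R]_(cw_dim b).+1 :=
  collapse b (@cw_char R S c (castmx (erefl, esym e) x)).

(* [b : c] extended to the empty cell, which has incidence 1 with every
   vertex; it is only meaningful for adim c = adim b + 1. *)
Definition aincidence (inc : cw_cell S -> cw_cell S -> int) (b c : acell) : int :=
  match b, c with
  | Some b', Some c' => inc b' c'
  | None, Some _ => 1
  | _, None => 0
  end.

(* The matrix with rows indexed by the k-cells and columns by the j-cells; for
   k = j - 1 this is the boundary matrix from C_j to C_(j-1). *)
Definition incidence_mx (inc : cw_cell S -> cw_cell S -> int) (k j : int) :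
    'M[int]_(#|cells k|, #|cells j|) :=
  \matrix_(a, b) aincidence inc (enum_val a) (enum_val b).

(* The augmented cellular chain complex of S.  The incidence numbers are the
   degrees of the maps [attach], hence determined by S in consecutive dimensions
   (the only ones ever used), and the last field, that the boundary squares to
   zero, is a standard consequence of the previous one. *)
Record cellular_chains := CellularChains {
  incidence : cw_cell S -> cw_cell S -> int;
  incidence_degree : forall (b c : cw_cell S) (e : cw_dim c = (cw_dim b).+1),
        has_degree (attach e) (incidence b c);
  incidence_boundary : forall j : int,
        incidence_mx incidence (j - 1) j *m incidence_mx incidence j (j + 1) = 0
}.

End Cells.

Section Trees.
Variables (R : realType) (S : finCW R) (C : cellular_chains S).

Definition boundary_mx (k j : int) : 'M[int]_(#|cells S k|, #|cells S j|) :=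
  incidence_mx (incidence C) k j.

Definition chains (T : {set acell S}) (j : int) : set 'cV[int]_#|cells S j| :=
  [set z : 'cV[int]_#|cells S j| | forall a, z a 0 != 0 -> enum_val a \in T].

Arguments chains T j _ : clear implicits.

Definition cycles (T : {set acell S}) (j : int) : set 'cV[int]_#|cells S j| :=
  [set z : 'cV[int]_#|cells S j| | chains T j z /\ boundary_mx (j - 1) j *m z = 0].

Arguments cycles T j _ : clear implicits.

Definition boundaries (T : {set acell S}) (j : int) :
    set 'cV[int]_#|cells S j| :=
  [set boundary_mx j (j + 1) *m u | u in chains T (j + 1)].

Arguments boundaries T j _ : clear implicits.

(* The reduced homology group, as the set of cosets of the boundaries in the
   cycles. *)
Definition homology (T : {set acell S}) (j : int) :
    set (set 'cV[int]_#|cells S j|) :=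
  [set [set z + w | w in boundaries T j] | z in cycles T j].

Arguments homology T j _ : clear implicits.

Definition homology0 (T : {set acell S}) (j : int) : Prop :=
  homology T j = [set boundaries T j].

(* Only meaningful when the homology group is finite. *)
Definition homology_card (T : {set acell S}) (j : int) : nat :=
  (#|` fset_set (homology T j)|)%fset.

Definition acyclic (j : int) : Prop :=
  forall k : int, - 1 <= k <= j -> homology0 [set: acell S]%SET k.

Definition is_tree (j : int) (T : {set acell S}) : Prop :=
  [/\ subcomplex T,
      skeleton S (j - 1) \subset T,
      T \subset skeleton S j &
      let P1 := homology0 T j in
      let P2 := finite_set (homology T (j - 1)) in
      let P3 := #|T :&: cells S j| = rank_dom (boundary_mx (j - 1) j) in
      [\/ P1 /\ P2, P1 /\ P3 | P2 /\ P3]].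

Definition tree_enum (j : int) : nat :=
  (\sum_(T : {set acell S} | `[< is_tree j T >])
     homology_card T (j - 1)%R ^ 2)%N.

(* The weighted enumerator evaluated at weights w of the j-cells. *)
Definition wtree_enum (j : int) (A : comNzRingType) (w : 'rV[A]_#|cells S j|) : A :=
  \sum_(T : {set acell S} | `[< is_tree j T >])
    (\prod_(a | enum_val a \in T) w 0 a) *
    (homology_card T (j - 1)%R ^ 2)%N%:R.

End Trees.

Arguments chains {R S} T j _.
Arguments cycles {R S} C T j _.
Arguments boundaries {R S} C T j _.
Arguments homology {R S} C T j _.
Arguments wtree_enum {R S} C j {A} w.

(* Main.v *)
(** Write [A] and [D] for the boundary matrices in degrees [i - 1] and [i].  By
    Cauchy-Binet, [pdet (D D^T)] is the sum of the squares of the minors of [D]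
    on [r] rows [I] and [r] columns [J], where [r] is the rank of [D].  Since
    [ker A = im D], such a minor is nonzero exactly when [J] spans an [i]-tree
    and the complement of [I] spans an [(i-1)]-tree.  In that case its absolute
    value is the index of [D_I Z^J] in [Z^I], which factors through the lattice
    [D_I Z^m]: projecting to the rows [I] identifies [D_I Z^m / D_I Z^J] with
    the homology [ker A / D Z^J] of the [i]-tree, and [A] identifies
    [Z^I / D_I Z^m] with the homology [A Z^n / A Z^(~I)] of the [(i-1)]-tree. *)

Require Import Defs.
From HB Require Import structures.
From mathcomp Require Import all_boot all_order all_algebra fingroup perm.
From mathcomp Require mpoly.

Set Implicit Arguments.
Unset Strict Implicit.
Unset Printing Implicit Defensive.

Import Order.TTheory GRing.Theory Num.Theory.
Local Open Scope ring_scope.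

(** * Minors, Cauchy-Binet and rank *)

Section Enum.
Variables (p q : nat).

(** Choosing an [h]-preimage of each [f i] gives a self-map of ['I_p] that is injective because [f]
    is, hence a permutation. This compares two enumerations of the same index set. *)
Lemma inj_perm_factor (h f : 'I_p -> 'I_q) :
    injective f -> (forall i, exists k, h k = f i) ->
  exists s : 'S_p, forall i, f i = h (s i).
Proof.
move=> finj /fin_all_exists[t ht].
have tinj : injective t by move=> i j ij; apply: finj; rewrite -!ht ij.
by exists (perm tinj) => i; rewrite permE ht.
Qed.

Lemma enum_val_cast_inj (J : {set 'I_q}) (e : p = #|J|) :
  injective (fun k => enum_val (cast_ord e k)).
Proof. by move=> i j /enum_val_inj /cast_ord_inj. Qed.

Lemma enum_val_cast_surj (J : {set 'I_q}) (e : p = #|J|) j :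
  j \in J -> exists k, enum_val (cast_ord e k) = j.
Proof.
move=> jJ; exists (cast_ord (esym e) (enum_rank_in jJ j)).
by rewrite cast_ordKV enum_rankK_in.
Qed.

End Enum.

Section CauchyBinet.
Variable R : comNzRingType.

(** Distribute the product over the sums defining the entries of [M *m N] in the Leibniz formula;
    for a fixed choice [f] of summation indices, the sum over permutations is the determinant of
    [rowsub f N]. *)
Lemma det_mulmx_ffun p q (M : 'M[R]_(p, q)) (N : 'M[R]_(q, p)) :
  \det (M *m N) =
    \sum_(f : {ffun 'I_p -> 'I_q}) (\prod_i M i (f i)) * \det (rowsub f N).
Proof.
rewrite /determinant.
under eq_bigr => s _.
  under eq_bigr do rewrite mxE.
  rewrite bigA_distr_bigA big_distrr /=; over.
rewrite exchange_big /=; apply: eq_bigr => f _.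
rewrite big_distrr /=; apply: eq_bigr => s _.
rewrite big_split /= mulrCA; congr (_ * (_ * _)).
by apply: eq_bigr => i _; rewrite !mxE.
Qed.

(* The value is [0] when [I] and [J] differ in size. *)
Definition minor p q (I : {set 'I_p}) (J : {set 'I_q}) (M : 'M[R]_(p, q)) : R :=
  if #|I| =P #|J| is ReflectT e
  then \det (mxsub enum_val (fun k => enum_val (cast_ord e k)) M) else 0.

Lemma minorE p q (I : {set 'I_p}) (J : {set 'I_q}) (M : 'M[R]_(p, q))
    (e : #|I| = #|J|) :
  minor I J M = \det (mxsub enum_val (fun k => enum_val (cast_ord e k)) M).
Proof.
rewrite /minor; case: eqP => // e'.
by rewrite (eq_irrelevance e e').
Qed.

(** The Cauchy-Binet formula. The summand is an abstract [G] because the square submatrices cut out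
    by [J] exist only once a proof of [p = #|J|] is given. *)
Lemma det_mulmx_sets p q (M : 'M[R]_(p, q)) (N : 'M[R]_(q, p))
    (G : {set 'I_q} -> R) :
    (forall (J : {set 'I_q}) (e : p = #|J|)
            (h := fun k => enum_val (cast_ord e k)),
       G J = \det (colsub h M) * \det (rowsub h N)) ->
  \det (M *m N) = \sum_(J : {set 'I_q} | #|J| == p) G J.
Proof.
move=> GE; rewrite det_mulmx_ffun (bigID (fun f : {ffun _} => injectiveb f)) /=.
(* A non-injective [f] repeats a row of [N], so its term vanishes; the injective ones are then
   grouped by their image [J]. *)
rewrite [X in _ + X]big1 ?addr0; last first.
  move=> f /injectivePn[i [j ij fij]].
  by rewrite (determinant_alternate ij) ?mulr0 // => k; rewrite !mxE fij.
rewrite (partition_big (fun f : {ffun 'I_p -> 'I_q} => [set f i | i : 'I_p])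
   (fun J : {set 'I_q} => #|J| == p)) /=; last first.
  by move=> f /injectiveP finj; rewrite card_imset // card_ord.
apply: eq_bigr => J /eqP/esym e; rewrite (GE J e) /=.
set h := fun k : 'I_p => enum_val (cast_ord e k).
pose g (s : 'S_p) : {ffun 'I_p -> 'I_q} := [ffun i => h (s i)].
have ginj : injective g.
  move=> s t /ffunP st; apply/permP => i; have := st i; rewrite !ffunE.
  exact: enum_val_cast_inj.
(* The injections with image [J] are exactly the maps [h \o s] with [s] a permutation. *)
rewrite (eq_bigl (fun f => f \in [set g s | s in [set: 'S_p]])); last first.
  move=> f; apply/andP/imsetP => [[/injectiveP finj /eqP fJ]|[s _ ->]].
    have [|s fs] := @inj_perm_factor _ _ h f finj.
      by move=> i; apply: enum_val_cast_surj; rewrite -fJ imset_f.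
    by exists s => //; apply/ffunP => i; rewrite ffunE.
  split.
    apply/injectiveP => i j; rewrite !ffunE => /enum_val_cast_inj.
    exact: perm_inj.
  apply/eqP/setP => j; apply/imsetP/idP => [[i _ ->]|jJ].
    by rewrite ffunE enum_valP.
  have [k <-] := enum_val_cast_surj e jJ.
  by exists (s^-1%g k); rewrite // ffunE permKV.
rewrite big_imset /=; last by move=> s t _ _ /ginj.
(* Each [rowsub (g s) N] is a row permutation of [rowsub h N]; its sign is the one needed in the
   Leibniz expansion of [\det (colsub h M)]. *)
rewrite [\det (colsub h M)]/determinant mulr_suml.
apply: eq_big => [s|s _]; first by rewrite inE.
have -> : rowsub (g s) N = row_perm s (rowsub h N).
  by apply/matrixP => i j; rewrite !mxE ffunE.
have -> : \det (row_perm s (rowsub h N)) = (-1) ^+ s * \det (rowsub h N).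
  by rewrite row_permE det_mulmx det_perm.
rewrite mulrA [_ * (-1) ^+ s]mulrC; congr (_ * _ * _).
by apply: eq_bigr => i _; rewrite !mxE ffunE.
Qed.

Lemma prod_enum_val_cast p q (J : {set 'I_q}) (e : p = #|J|) (F : 'I_q -> R) :
  \prod_k F (enum_val (cast_ord e k)) = \prod_(j in J) F j.
Proof.
rewrite [RHS]big_enum_val /= (reindex (cast_ord e)) //.
by apply: onW_bij; exists (cast_ord (esym e));
   [apply: cast_ordK | apply: cast_ordKV].
Qed.

(** The outer diagonal factors restrict to [I] and contribute their determinant twice. What remains
    is Cauchy-Binet for the rows [I] of [M] scaled by [y], times the transpose of these rows. *)
Lemma det_weighted_gram p q (M : 'M[R]_(p, q)) (s : 'rV[R]_p) (y : 'rV[R]_q)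
    (I : {set 'I_p}) :
  \det (mxsub (@enum_val _ (mem I)) (@enum_val _ (mem I))
         (diag_mx s *m M *m diag_mx y *m M^T *m diag_mx s)) =
  (\prod_(i in I) s 0 i ^+ 2) *
    \sum_(J : {set 'I_q} | #|J| == #|I|)
      (\prod_(j in J) y 0 j) * minor I J M ^+ 2.
Proof.
set v := @enum_val _ _.
have -> : mxsub v v (diag_mx s *m M *m diag_mx y *m M^T *m diag_mx s) =
   diag_mx (colsub v s) *m (rowsub v M *m diag_mx y *m (rowsub v M)^T)
    *m diag_mx (colsub v s).
  have -> : rowsub v M *m diag_mx y *m (rowsub v M)^T =
      mxsub v v (M *m diag_mx y *m M^T).
    apply/matrixP => i j; rewrite !mxE; apply: eq_bigr => k _.
    by rewrite !mul_mx_diag !mxE.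
  rewrite -[_ *m M *m _]mulmxA -[_ *m M^T]mulmxA; move: (M *m _ *m _) => G.
  by apply/matrixP => i j; rewrite mxE !mul_mx_diag !mul_diag_mx !mxE.
rewrite !det_mulmx det_diag mulrAC -expr2 -prodrXl.
congr (_ * _).
  rewrite [RHS]big_enum_val /=; apply: eq_bigr => i _; by rewrite !mxE.
apply: det_mulmx_sets => J e h.
rewrite (minorE _ e) expr2 mulrA; congr (_ * _); last first.
  by rewrite -det_tr; congr (\det _); apply/matrixP => i j; rewrite !mxE.
have -> : colsub h (rowsub v M *m diag_mx y) =
    mxsub v h M *m diag_mx (colsub h y).
  by apply/matrixP => i j; rewrite mxE !mul_mx_diag !mxE.
rewrite det_mulmx det_diag mulrC; congr (_ * _).
by rewrite -(prod_enum_val_cast e); apply: eq_bigr => k _; rewrite !mxE.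
Qed.

End CauchyBinet.

Lemma minor_map (R R' : comNzRingType) (f : {rmorphism R -> R'}) p q
    (I : {set 'I_p}) (J : {set 'I_q}) (M : 'M[R]_(p, q)) :
  minor I J (map_mx f M) = f (minor I J M).
Proof.
rewrite /minor; case: eqP => [e|_]; last by rewrite rmorph0.
by rewrite -det_map_mx map_mxsub.
Qed.

Lemma mxrank_mxsub (F : fieldType) p q p' q' (f : 'I_p' -> 'I_p)
    (g : 'I_q' -> 'I_q) (M : 'M[F]_(p, q)) :
  (\rank (mxsub f g M) <= \rank M)%N.
Proof.
have rs a b c (u : 'I_a -> 'I_b) (N : 'M[F]_(b, c)) :
    (\rank (rowsub u N) <= \rank N)%N.
  apply: mxrankS; apply/row_subP => k; rewrite row_rowsub; exact: row_sub.
have -> : mxsub f g M = rowsub f (colsub g M).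
  by apply/matrixP => i j; rewrite !mxE.
apply: leq_trans (rs _ _ _ _ _) _.
have -> : colsub g M = (rowsub g M^T)^T by apply/matrixP => i j; rewrite !mxE.
by rewrite mxrank_tr (leq_trans (rs _ _ _ _ _)) // mxrank_tr.
Qed.

Lemma minor_neq0_rank (F : fieldType) p q (I : {set 'I_p}) (J : {set 'I_q})
    (M : 'M[F]_(p, q)) :
  minor I J M != 0 -> (#|I| <= \rank M)%N.
Proof.
rewrite /minor; case: eqP => [e|]; last by rewrite eqxx.
rewrite -unitfE -unitmxE => /mxrank_unit <-; exact: mxrank_mxsub.
Qed.

Lemma minor_castE (R : comNzRingType) p q r (I : {set 'I_p}) (J : {set 'I_q})
    (M : 'M[R]_(p, q)) (eI : r = #|I|) (eJ : r = #|J|) :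
  minor I J M = \det (mxsub (fun k => enum_val (cast_ord eI k))
                            (fun k => enum_val (cast_ord eJ k)) M).
Proof.
subst r; rewrite (minorE _ eJ); congr (\det _); apply/matrixP => i j.
by rewrite !mxE cast_ord_id.
Qed.

(** The maps [f] and [g] need not list their images in the order of [enum_val]; reordering rows and
    columns changes the determinant only by a sign. *)
Lemma minor_imset_neq0 (F : fieldType) p q r (f : 'I_r -> 'I_p)
    (g : 'I_r -> 'I_q) (M : 'M[F]_(p, q)) :
    injective f -> injective g -> \det (mxsub f g M) != 0 ->
  minor [set f i | i : 'I_r] [set g i | i : 'I_r] M != 0.
Proof.
move=> finj ginj; set I := [set f i | i : 'I_r]; set J := [set g i | i : 'I_r].
have eI : r = #|I| by rewrite card_imset // card_ord.
have eJ : r = #|J| by rewrite card_imset // card_ord.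
have [|s fs] := @inj_perm_factor _ _ (fun k => enum_val (cast_ord eI k)) f finj.
  by move=> i; apply: enum_val_cast_surj; rewrite imset_f.
have [|t gt] := @inj_perm_factor _ _ (fun k => enum_val (cast_ord eJ k)) g ginj.
  by move=> i; apply: enum_val_cast_surj; rewrite imset_f.
rewrite (minor_castE _ eI eJ).
set h := fun k : 'I_r => enum_val _; set h' := fun k : 'I_r => enum_val _.
have -> : mxsub f g M = row_perm s (col_perm t (mxsub h h' M)).
  by apply/matrixP => i j; rewrite !mxE fs gt.
by rewrite row_permE col_permE !det_mulmx !mulf_eq0 !negb_or => /and3P[].
Qed.

(** Select a maximal free family of rows, then a maximal free family of columns among those rows. *)
Lemma exists_minor_neq0 (F : fieldType) p q (M : 'M[F]_(p, q)) :
  exists (I : {set 'I_p}) (J : {set 'I_q}),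
    [/\ #|I| = \rank M, #|J| = \rank M & minor I J M != 0].
Proof.
pose f := maxrankfun M.
have full : row_full (rowsub f M)^T.
  by rewrite /row_full mxrank_tr; apply: maxrowsub_free.
pose g := fullrankfun full.
exists [set f i | i : 'I_(\rank M)], [set g i | i : 'I_(\rank M)].
rewrite !card_imset ?card_ord; [|exact: fullrankfun_inj|exact: maxrankfun_inj].
split=> //; apply: minor_imset_neq0;
  [exact: maxrankfun_inj | exact: fullrankfun_inj |].
have := fullrowsub_unit full; rewrite -unitmx_tr unitmxE unitfE.
by congr (\det _ != 0); apply/matrixP => i j; rewrite !mxE.
Qed.

(** A minor of maximal size that is nonzero over [K] is the image of a nonzero minor over [A], which
    the injective [g] keeps nonzero in [K']. *)
Lemma mxrank_map_le (A : comNzRingType) (K K' : fieldType)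
    (f : {rmorphism A -> K}) (g : {rmorphism A -> K'}) p q (M : 'M[A]_(p, q)) :
    (forall a, g a = 0 -> a = 0) ->
  (\rank (map_mx f M) <= \rank (map_mx g M))%N.
Proof.
move=> ginj; have [I [J [<- _]]] := exists_minor_neq0 (map_mx f M).
rewrite minor_map => nz; apply: (@minor_neq0_rank _ _ _ _ J).
rewrite minor_map; apply: contra nz => /eqP/ginj ->.
by rewrite rmorph0.
Qed.

(** * Nonvanishing of polynomials in the indeterminates *)

(* The notations of [mpoly] clash with those of the analysis library, so it is
   imported locally, before the latter. *)
Module Nonvanishing.
Import mpoly.

(** Both [iota] and the embedding into fractions are injective, so it is enough that [P] be nonzero,
    which its value at the all-ones point certifies. *)
Lemma iota_tofrac_neq0 (k : nat) (F : fieldType)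
    (iota : {rmorphism ratfun k -> F}) (P : {mpoly int[k]}) :
  P.@[fun=> 1] != 0 -> iota (FracField.tofrac P) != 0.
Proof.
move=> P1; rewrite fmorph_eq0 tofrac_eq0.
by apply: contraNneq P1 => ->; rewrite meval0.
Qed.

Lemma iota_indet_neq0 (k : nat) (F : fieldType)
    (iota : {rmorphism ratfun k -> F}) (j : 'I_k) : iota (indet j) != 0.
Proof. by apply: iota_tofrac_neq0; rewrite mevalXU oner_neq0. Qed.

(** The expression is the image of a polynomial whose value at the all-ones point is the sum of the
    [c J]. It is applied with squares of minors as the [c J]. *)
Lemma iota_sum_neq0 (k : nat) (F : fieldType)
    (iota : {rmorphism ratfun k -> F}) (U V : finType) (f : U -> 'I_k)
    (g : V -> 'I_k) (I : {set U}) (Q : pred {set V}) (c : {set V} -> int) :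
    \sum_(J | Q J) c J != 0 ->
  (\prod_(i in I) iota (indet (f i))) *
    (\sum_(J | Q J) (\prod_(j in J) iota (indet (g j))) * (c J)%:~R) != 0.
Proof.
move=> c0.
pose P : {mpoly int[k]} := (\prod_(i in I) 'X_(f i)) *
    (\sum_(J | Q J) (\prod_(j in J) 'X_(g j)) * (c J)%:~R).
have -> : (\prod_(i in I) iota (indet (f i))) *
    (\sum_(J | Q J) (\prod_(j in J) iota (indet (g j))) * (c J)%:~R) =
    iota (FracField.tofrac P).
  rewrite !rmorphM !rmorph_prod !rmorph_sum /=; congr (_ * _).
  apply: eq_bigr => J _; rewrite !rmorphM !rmorph_prod /= !rmorph_int.
  by congr (_ * _).
apply: iota_tofrac_neq0; rewrite rmorphM rmorph_prod rmorph_sum /=.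
rewrite big1 ?mul1r => [|i _]; last by rewrite mevalXU.
rewrite (eq_bigr c) // => J _.
rewrite rmorphM rmorph_prod rmorph_int /= big1 => [|j _].
  by rewrite mul1r intz.
by rewrite mevalXU.
Qed.

End Nonvanishing.

From mathcomp Require Import all_classical reals topology normedtype trigo.

Local Open Scope classical_set_scope.
Local Open Scope card_scope.

(** * Cosets and lattice indices *)

Section Cosets.
Variable V : zmodType.

Definition subgroup (B : set V) : Prop :=
  B 0 /\ forall x y, B x -> B y -> B (x - y).

Lemma subgroupN B x : subgroup B -> B x -> B (- x).
Proof. by move=> [B0 BB] Bx; rewrite -sub0r; apply: BB. Qed.

Lemma subgroupD B x y : subgroup B -> B x -> B y -> B (x + y).
Proof.
by move=> sB Bx By; rewrite -[y]opprK; apply: sB.2 => //; apply: subgroupN.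
Qed.

Definition cosets (Z B : set V) : set (set V) :=
  [set [set z + w | w in B] | z in Z].

Lemma eq_coset B x y : subgroup B ->
  ([set x + w | w in B] = [set y + w | w in B]) <-> B (x - y).
Proof.
move=> sB; split=> [exy|Bxy].
  have : [set x + w | w in B] x by exists 0; rewrite ?addr0 //; apply: sB.1.
  by rewrite exy => -[w Bw <-]; rewrite addrAC subrr add0r.
apply/seteqP; split=> _ [w Bw <-].
  by exists (x - y + w); [exact: subgroupD | rewrite addrA [y + _]addrC subrK].
exists (w - (x - y)); first exact: sB.2.
by rewrite opprB addrCA [x + _]addrC subrK addrC.
Qed.

(** A system of representatives of [Z] modulo [B]. Indices of subgroups are computed as
    cardinalities of such systems [I], without forming quotient groups. *)
Definition transversal (I : finType) (Z B : set V) (x : I -> V) : Prop :=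
  [/\ forall i, Z (x i), forall i j, B (x i - x j) -> i = j &
      forall z, Z z -> exists i, B (z - x i)].

Lemma card_cosets (I : finType) (Z B : set V) (x : I -> V) :
  subgroup B -> transversal Z B x -> cosets Z B #= `I_#|I|.
Proof.
move=> sB [Zx xinj xsurj].
have -> : cosets Z B =
    [set [set x (enum_val k) + w | w in B] | k in [set: 'I_#|I|]].
  apply/seteqP; split=> [_ [z Zz <-]|_ [k _ <-]]; last first.
    by exists (x (enum_val k)).
  have [i Bi] := xsurj _ Zz; exists (enum_rank i) => //.
  by rewrite enum_rankK; apply/esym/eq_coset.
apply: (card_eq_trans _ (_ : [set: 'I_#|I|] #= `I_#|I|)); last first.
  by rewrite card_eq_sym; apply: card_II.
apply: inj_card_eq => k l _ _ /eq_coset => /(_ sB) /xinj.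
exact: enum_val_inj.
Qed.

Lemma exists_transversal (Z B : set V) :
    subgroup B -> finite_set (cosets Z B) ->
  exists (k : nat) (x : 'I_k -> V), transversal Z B x.
Proof.
move=> sB /finite_setP[k ek].
have /card_set_bijP[f [fS finj fsurj]] : [set: 'I_k] #= cosets Z B.
  by rewrite card_eq_sym; apply: card_eq_trans ek card_II.
exists k.
have fun_f i : exists z, Z z /\ f i = [set z + w | w in B].
  have : cosets Z B (f i) by apply: fS.
  by case=> z Zz <-; exists z.
have [x hx] := choice fun_f; exists x; split.
- by move=> i; case: (hx i).
- move=> i j /(eq_coset _ _ sB); rewrite -(hx i).2 -(hx j).2.
  by apply: finj; rewrite inE.
- move=> z Zz.
  have [|i _ fi] := fsurj [set z + w | w in B].
    by exists z.
  exists i; apply/(eq_coset _ _ sB); rewrite -fi; exact: (hx i).2.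
Qed.

(** Multiplicativity of the index, [[Z : B] = [Z : M] [M : B]], at the level of representatives. *)
Lemma transversal_tower (I J : finType) (Z M B : set V) (x : I -> V)
    (y : J -> V) :
    subgroup Z -> subgroup M -> B `<=` M -> M `<=` Z ->
    transversal Z M x -> transversal M B y ->
  transversal Z B (fun k : I * J => x k.1 + y k.2).
Proof.
move=> sZ sM BM MZ [Zx xinj xsurj] [My yinj ysurj]; split.
- by move=> k; apply: subgroupD => //; apply: MZ.
- move=> [i j] [i' j'] /= Bxy.
  have ii : i = i'.
    apply: xinj; have := subgroupD sM (BM _ Bxy) (sM.2 _ _ (My j') (My j)).
    by rewrite opprD !addrA subrK addrAC addrK.
  rewrite ii; congr (_, _); apply: yinj; move: Bxy.
  by rewrite ii opprD addrACA subrr add0r.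
- move=> z /xsurj[i /ysurj[j Bj]]; exists (i, j) => /=.
  by rewrite opprD addrA.
Qed.

Lemma finite_cosets_sub (Z M B : set V) :
  M `<=` Z -> finite_set (cosets Z B) -> finite_set (cosets M B).
Proof.
by move=> MZ; apply: sub_finite_set => _ [z /MZ Zz <-]; exists z.
Qed.

(** Adding [M] to a coset of [B] maps the cosets of [B] onto the cosets of [M]. *)
Lemma finite_cosets_quo (Z M B : set V) :
  subgroup M -> subgroup B -> B `<=` M ->
  finite_set (cosets Z B) -> finite_set (cosets Z M).
Proof.
move=> sM sB BM /(finite_image (fun c => [set x + m | x in c & m in M])).
apply: sub_finite_set => _ [z Zz <-].
exists [set z + w | w in B]; first by exists z.
apply/seteqP; split=> [_ [_ [b Bb <-]] [w Mw <-]|_ [w Mw <-]].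
  by exists (b + w); [apply: subgroupD => //; apply: BM | rewrite addrA].
exists z; first by exists 0; [exact: sB.1 | rewrite addr0].
by exists w.
Qed.

End Cosets.

(** * Transport of an index along a homomorphism *)

Section CosetImage.
Variables (V W : zmodType) (f : {additive V -> W}) (Z B : set V).
Hypotheses (sZ : subgroup Z) (sB : subgroup B) (BZ : B `<=` Z).
Hypothesis kerf : forall z, Z z -> f z = 0 -> B z.

Lemma subgroup_image : subgroup (f @` B).
Proof.
split; first by exists 0; [exact: sB.1 | rewrite raddf0].
move=> _ _ [x Bx <-] [y By <-].
by exists (x - y); [exact: sB.2 | rewrite raddfB].
Qed.

Lemma image_inB x : Z x -> (f @` B) (f x) -> B x.
Proof.
move=> Zx [b Bb fb]; rewrite -[x](subrK b); apply: subgroupD => //.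
by apply: kerf; [apply: sZ.2 => //; apply: BZ | rewrite raddfB fb subrr].
Qed.

(** Since the kernel of [f] on [Z] lies in [B], [f] induces an isomorphism from [Z / B] onto
    [f(Z) / f(B)]; representatives are pushed forward here and pulled back in [transversal_lift]. *)
Lemma transversal_image (I : finType) (x : I -> V) :
  transversal Z B x -> transversal (f @` Z) (f @` B) (f \o x).
Proof.
move=> [Zx xinj xsurj]; split=> [i|i j|_ [z /[dup] Zz /xsurj[i Bi] <-]] /=.
- by exists (x i).
- by rewrite -raddfB => /image_inB xij; apply: xinj; apply: xij; apply: sZ.2.
- by exists i; exists (z - x i); rewrite ?raddfB.
Qed.

Lemma transversal_lift (I : finType) (y : I -> W) :
    transversal (f @` Z) (f @` B) y ->
  exists x : I -> V, transversal Z B x.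
Proof.
move=> [Zy yinj ysurj].
have /choice[x hx] i : exists z, Z z /\ f z = y i.
  by have [z Zz <-] := Zy i; exists z.
exists x; split=> [i|i j xij|z Zz]; first by case: (hx i).
- by apply: yinj; rewrite -(hx i).2 -(hx j).2 -raddfB; exists (x i - x j).
- have [|i Bi] := ysurj (f z); first by exists z.
  exists i; apply: image_inB; first by apply: sZ.2 => //; case: (hx i).
  by rewrite raddfB (hx i).2.
Qed.

End CosetImage.

(** * The index of the image of a square integer matrix *)

Lemma absz_det_unit r (L : 'M[int]_r) : L \in unitmx -> `|\det L|%N = 1%N.
Proof.
move=> uL; have /(congr1 absz) : \det L * \det (invmx L) = 1.
  by rewrite -det_mulmx mulmxV // det1.
by rewrite abszM => /eqP; rewrite muln_eq1 => /andP[/eqP].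
Qed.

Lemma subgroup_range p q (M : 'M[int]_(p, q)) :
  subgroup (range (fun u : 'cV_q => M *m u)).
Proof.
split; first by exists 0; rewrite ?mulmx0.
by move=> _ _ [u _ <-] [v _ <-]; exists (u - v); rewrite ?mulmxBr.
Qed.

(** The representatives are the vectors whose [i]-th entry is a remainder modulo [d i]; entrywise
    Euclidean division finds the representative of a given vector. *)
Lemma transversal_diag r (d : nat -> int) (D := diag_mx (\row_(i < r) d i)) :
    (forall i : 'I_r, d i != 0) ->
  exists (I : finType) (x : I -> 'cV[int]_r),
    transversal setT (range (fun u : 'cV_r => D *m u)) x /\
    #|I| = (\prod_(i < r) `|d i|)%N.
Proof.
move=> d0; pose I : finType := {dffun forall i : 'I_r, 'I_`|d i|%N}.
exists I, (fun g : I => \col_i (g i : nat)%:Z); split; last first.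
  rewrite card_dep_ffun foldrE big_map /= big_enum /=.
  by apply: eq_bigr => i _; rewrite card_ord.
split=> // [g g' [u _ /matrixP e]|z _].
  apply/ffunP => i; apply: val_inj; have := e i 0.
  rewrite mul_diag_mx !mxE => ei.
  have : (g i = g' i %[mod d i])%Z.
    by apply/eqP; rewrite eqz_mod_dvd -ei dvdz_mulr.
  have small (k : 'I_`|d i|%N) : (k%:Z %% d i)%Z = k%:Z.
    by rewrite -modz_abs modz_small //= ltz_nat ltn_ord.
  by rewrite !small => -[].
have h i : (`|(z i 0%R %% d i)%Z| < `|d i|)%N.
  by rewrite -ltz_nat gez0_abs ?modz_ge0 //; apply: ltz_mod.
exists [ffun i => Ordinal (h i)].
exists (\col_i (z i 0%R %/ d i)%Z) => //.
apply/matrixP => i j; rewrite ord1 mul_diag_mx !mxE ffunE /=.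
by rewrite gez0_abs ?modz_ge0 // {2}(divz_eq (z i 0) (d i)) addrK mulrC.
Qed.

(** By the Smith normal form [M = L D R], multiplication by the inverse of [L] preserves [Z^r] and
    carries [M Z^r] onto [D Z^r], because [R] is unimodular. This reduces the index to the diagonal
    case. *)
Lemma transversal_det r (M : 'M[int]_r) : \det M != 0 ->
  exists (I : finType) (x : I -> 'cV[int]_r),
    transversal setT (range (fun u : 'cV_r => M *m u)) x /\
    #|I| = `|\det M|%N.
Proof.
have [L uL [R uR [d _ ->]]] := int_Smith_normal_form M.
have -> : \matrix_(i, j) (d`_i *+ (i == j :> nat)) =
    diag_mx (\row_(i < r) d`_i).
  by apply/matrixP => i j; rewrite !mxE.
rewrite !det_mulmx !abszM (absz_det_unit uL) (absz_det_unit uR).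
rewrite mul1n muln1 det_diag.
set D := diag_mx _ => dnz.
have d0 (i : 'I_r) : d`_i != 0.
  move: dnz; rewrite !mulf_eq0 !negb_or => /andP[/andP[_]].
  by move=> /prodf_neq0/(_ i isT); rewrite mxE.
have [I [x [xT cI]]] := transversal_diag d0.
pose f : {additive 'cV[int]_r -> 'cV[int]_r} := mulmx (invmx L).
have fT : f @` setT = setT.
  apply/seteqP; split=> // y _; exists (L *m y) => //=.
  by rewrite /f /= mulKmx.
have fM : f @` range (fun u : 'cV_r => L *m D *m R *m u) =
    range (fun u : 'cV_r => D *m u).
  apply/seteqP; split=> [_ [_ [u _ <-] <-]|_ [u _ <-]].
    by exists (R *m u) => //; rewrite /f /= -!mulmxA mulKmx.
  exists (L *m D *m u); last by rewrite /f /= -mulmxA mulKmx.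
  by exists (invmx R *m u) => //; rewrite -!mulmxA mulKVmx.
have [|||z _||x' x'T] := @transversal_lift _ _ f setT
    (range (fun u : 'cV_r => L *m D *m R *m u)) _ _ _ _ I x.
- by [].
- exact: subgroup_range.
- by [].
- move=> /(congr1 (mulmx L)); rewrite /f /= mulKVmx // mulmx0 => ->.
  exact: (subgroup_range _).1.
- by rewrite fT fM.
exists I, x'; split=> //; rewrite cI.
under [in RHS]eq_bigr do rewrite mxE.
by rewrite (big_morph absz abszM (erefl _)).
Qed.

(** * Exact pairs of integer matrices *)

Definition rank_rat p q (M : 'M[int]_(p, q)) : nat :=
  \rank (map_mx (intr : int -> rat) M).

(** The product of the denominators of all the entries serves as common denominator. *)
Lemma clear_denominators p q (M : 'M[rat]_(p, q)) :
  exists (N : int) (W : 'M[int]_(p, q)),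
    N != 0 /\ map_mx intr W = N%:~R *: M.
Proof.
exists (\prod_(k : 'I_p * 'I_q) denq (M k.1 k.2)).
exists (\matrix_(i, j) (numq (M i j) *
          \prod_(k | k != (i, j)) denq (M k.1 k.2))); split.
  by apply/prodf_neq0 => k _; apply: denq_neq0.
apply/matrixP => i j; rewrite !mxE [in RHS](bigD1 (i, j)) //= !intrM.
by rewrite mulrAC [_%:~R * M i j]mulrC -numqE.
Qed.

Lemma map_intr_mx_eq0 p q (M : 'M[int]_(p, q)) :
  map_mx (intr : int -> rat) M = 0 -> M = 0.
Proof.
move=> /matrixP M0; apply/matrixP => i j; have := M0 i j; rewrite !mxE.
by move/eqP; rewrite intr_eq0 => /eqP.
Qed.

(** A rational kernel vector becomes an integral one after clearing denominators, so injectivity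
    over the integers is full column rank over the rationals. *)
Lemma rank_rat_inj p q (M : 'M[int]_(p, q)) :
  (forall u : 'cV_q, M *m u = 0 -> u = 0) <-> rank_rat M = q.
Proof.
rewrite /rank_rat -mxrank_tr; split=> [inj|/eqP free u Mu].
  apply/eqP/inj_row_free => v.
  have [N [W [N0 NW]]] := clear_denominators v.
  move=> /(congr1 ( *:%R N%:~R)); rewrite scalemxAl -NW scaler0 map_trmx.
  rewrite -map_mxM => /map_intr_mx_eq0 /(congr1 trmx).
  rewrite trmx_mul trmxK trmx0 => /inj /(congr1 trmx).
  rewrite trmxK trmx0 => W0.
  move/eqP: NW; rewrite W0 map_mx0 eq_sym scaler_eq0 intr_eq0 (negPf N0).
  by move/eqP.
apply: map_intr_mx_eq0; apply: trmx_inj; rewrite trmx0; apply/eqP.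
rewrite -(mulmx_free_eq0 _ free) -trmx_mul -map_mxM Mu map_mx0.
by rewrite trmx0.
Qed.

(** * Vectors supported on a set of coordinates *)

Section Supported.
Variable m : nat.

Definition supported (J : {set 'I_m}) : set 'cV[int]_m :=
  [set u : 'cV[int]_m | forall j, u j 0 != 0 -> j \in J].

(** The inclusion of [Z^J] into [Z^m], which parametrises [supported J] and turns restriction of a
    matrix to it into a selection of columns. *)
Definition incl_mx (J : {set 'I_m}) : 'M[int]_(m, #|J|) :=
  colsub (@enum_val _ (mem J)) 1%:M.

Lemma mul_incl_mx n (D : 'M[int]_(n, m)) J :
  D *m incl_mx J = colsub (@enum_val _ (mem J)) D.
Proof. by rewrite /incl_mx mulmx_colsub mulmx1. Qed.

Lemma incl_mx_supported J w : supported J (incl_mx J *m w).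
Proof.
move=> j; apply: contraNT => jJ; rewrite mxE big1 // => k _.
rewrite !mxE; case: eqP => [jk|_]; last by rewrite mul0r.
by rewrite jk enum_valP in jJ.
Qed.

Lemma rowsub_incl_mx (J : {set 'I_m}) (w : 'cV_#|J|) :
  rowsub (@enum_val _ (mem J)) (incl_mx J *m w) = w.
Proof.
rewrite -mul_rowsub_mx -[RHS]mul1mx; congr (_ *m _).
by apply/matrixP => k l; rewrite !mxE (inj_eq enum_val_inj).
Qed.

Lemma supportedP J u : supported J u ->
  u = incl_mx J *m rowsub (@enum_val _ (mem J)) u.
Proof.
move=> uJ; apply/matrixP => j o; rewrite ord1.
case: (boolP (j \in J)) => jJ.
  rewrite -{1 2}(enum_rankK_in jJ jJ); set k := enum_rank_in _ _.
  have /matrixP/(_ k 0) := rowsub_incl_mx (rowsub (@enum_val _ (mem J)) u).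
  by rewrite [RHS]mxE [LHS]mxE.
transitivity (0 : int); first by apply/eqP; apply: contraNT jJ; apply: uJ.
by apply/esym/eqP; apply: contraNT jJ; apply: incl_mx_supported.
Qed.

Lemma image_supported n (D : 'M[int]_(n, m)) J :
  [set D *m u | u in supported J] =
  range (fun w : 'cV_#|J| => colsub (@enum_val _ (mem J)) D *m w).
Proof.
apply/seteqP; split=> [_ [u /supportedP -> <-]|_ [w _ <-]].
  by rewrite mulmxA mul_incl_mx; eexists.
exists (incl_mx J *m w); first exact: incl_mx_supported.
by rewrite mulmxA mul_incl_mx.
Qed.

Lemma supported_inj n (D : 'M[int]_(n, m)) J :
  (forall u, supported J u -> D *m u = 0 -> u = 0) <->
  rank_rat (colsub (@enum_val _ (mem J)) D) = #|J|.
Proof.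
rewrite -rank_rat_inj; split=> [inj w Dw|inj u /supportedP eu Du].
  rewrite -(rowsub_incl_mx w) (inj _ (@incl_mx_supported _ w)).
    by apply/matrixP => k o; rewrite !mxE.
  by rewrite mulmxA mul_incl_mx.
rewrite eu (inj (rowsub _ u)) ?mulmx0 //.
by rewrite -mul_incl_mx -mulmxA -eu.
Qed.

End Supported.

(** Finiteness forces a nonzero multiple of each column of [D] into the image of [E], so the columns
    of [D] lie in the rational column space of [E]. *)
Lemma finite_cosets_rank n m k (D : 'M[int]_(n, m)) (E : 'M[int]_(n, k)) :
    finite_set (cosets (range (fun u : 'cV_m => D *m u))
                       (range (fun w : 'cV_k => E *m w))) ->
  (rank_rat D <= rank_rat E)%N.
Proof.
set Z := range _; set B := range _ => fin.
have sB : subgroup B by apply: subgroup_range.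
rewrite /rank_rat -mxrank_tr -[leqRHS]mxrank_tr; apply: mxrankS.
apply/row_subP => j; pose v := col j D.
pose g (c : nat) := [set c%:Z *: v + w | w in B].
(* Pigeonhole: the multiples [c v] with [c] a natural number meet only finitely many cosets, so two
   of them agree modulo [B]. *)
have [c [c' [cc' gc]]] : exists c c' : nat, c <> c' /\ g c = g c'.
  apply: contrapT => nex; apply: infinite_nat.
  have ginj : {in [set: nat] &, injective g}.
    move=> c c' _ _ gc; apply: contrapT => cc'; apply: nex.
    by exists c, c'.
  rewrite -(eq_finite_set (inj_card_eq ginj)).
  apply: sub_finite_set fin => _ [c _ <-]; exists (c%:Z *: v) => //.
  by exists (c%:Z *: delta_mx j 0) => //; rewrite -scalemxAr -colE.
have {gc} [w _ ew] := (eq_coset _ _ sB).1 gc.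
have c0 : (c%:Z - c'%:Z)%:~R != 0 :> rat.
  by rewrite intr_eq0 subr_eq0 eqz_nat; apply/eqP.
have -> : row j (map_mx intr D)^T =
    ((c%:Z - c'%:Z)%:~R^-1 *: (map_mx intr w)^T) *m (map_mx intr E)^T
    :> 'rV[rat]_n.
  rewrite -scalemxAl -trmx_mul -map_mxM ew -scalerBl map_mxZ linearZ /=.
  rewrite scalerA mulVf // scale1r; apply/matrixP => a b.
  by rewrite !mxE.
exact: submxMl.
Qed.

Section Exact.
Variables (p n m : nat) (A : 'M[int]_(p, n)) (D : 'M[int]_(n, m)).
Hypothesis AD0 : A *m D = 0.
Hypothesis exactAD : forall v : 'cV_n, A *m v = 0 -> exists u, v = D *m u.

(** Clearing denominators makes the pair exact over the rationals as well; the claim is then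
    rank-nullity for [A]. *)
Lemma rank_exact : (rank_rat A + rank_rat D = n)%N.
Proof.
rewrite /rank_rat; set A' := map_mx _ A; set D' := map_mx _ D.
have -> : \rank D' = \rank (kermx A'^T).
  rewrite -mxrank_tr; apply/eqP; rewrite eqn_leq; apply/andP; split.
    apply: mxrankS; apply/sub_kermxP.
    by rewrite -trmx_mul -map_mxM AD0 map_mx0 trmx0.
  apply: mxrankS; apply/rV_subP => v /sub_kermxP.
  have [N [W [N0 NW]]] := clear_denominators v.
  move=> /(congr1 ( *:%R N%:~R)); rewrite scalemxAl -NW scaler0 map_trmx.
  rewrite -map_mxM => /map_intr_mx_eq0 /(congr1 trmx).
  rewrite trmx_mul trmxK trmx0 => /exactAD[u eu].
  have -> : v = (N%:~R^-1 *: (map_mx intr u)^T) *m D'^T.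
    rewrite -scalemxAl -trmx_mul -map_mxM -eu map_trmx trmxK NW.
    by rewrite scalerA mulVf ?scale1r // intr_eq0.
  exact: submxMl.
by rewrite mxrank_ker mxrank_tr subnKC // rank_leq_col.
Qed.

Section Minor.
Variables (I : {set 'I_n}) (J : {set 'I_m}).
Hypothesis eIJ : #|I| = #|J|.

Let hI : 'I_#|I| -> 'I_n := @enum_val _ (mem I).
Let hJ (k : 'I_#|I|) : 'I_m := enum_val (cast_ord eIJ k).
Let M := mxsub hI hJ D.

Lemma minor_det : minor I J D = \det M.
Proof. exact: minorE. Qed.

Lemma supported_notin (v : 'cV[int]_n) :
  supported (~: I)%SET v <-> rowsub hI v = 0.
Proof.
split=> [vI|/matrixP v0 i vi].
  apply/matrixP => k o; rewrite ord1 !mxE; apply/eqP; apply: contraT => /vI.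
  by rewrite inE enum_valP.
rewrite inE; apply: contra vi => iI; have := v0 (enum_rank_in iI i) 0.
by rewrite !mxE /hI enum_rankK_in // => ->.
Qed.

Lemma rowsub_hJ_eq0 u : supported J u -> rowsub hJ u = 0 -> u = 0.
Proof.
move=> /supportedP -> /matrixP u0; rewrite (_ : rowsub _ u = 0) ?mulmx0 //.
apply/matrixP => k o; rewrite ord1.
have := u0 (cast_ord (esym eIJ) k) 0; rewrite !mxE /hJ cast_ordKV.
have /matrixP/(_ k 0) := rowsub_incl_mx (rowsub (@enum_val _ (mem J)) u).
by rewrite !mxE => -> ->.
Qed.

Lemma rowsub_hJ_ext (w : 'cV[int]_#|I|) :
  exists2 u, supported J u & rowsub hJ u = w.
Proof.
exists (incl_mx J *m rowsub (cast_ord (esym eIJ)) w).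
  exact: incl_mx_supported.
apply/matrixP => k o.
have /matrixP/(_ (cast_ord eIJ k) o) :=
  rowsub_incl_mx (rowsub (cast_ord (esym eIJ)) w).
by rewrite ord1 mxE => e; rewrite mxE e mxE cast_ordK.
Qed.

(** In the coordinates [J] of the source and [I] of the target, [D] acts on vectors supported on [J]
    as the square matrix [M]. *)
Lemma rowsub_hI_mul u : supported J u ->
  rowsub hI (D *m u) = M *m rowsub hJ u.
Proof.
move=> uJ; apply/matrixP => k o; rewrite !mxE ord1.
rewrite (bigID (mem J)) /= [X in _ + X]big1 ?addr0; last first.
  move=> j jJ; have /eqP -> : u j 0 == 0 by apply: contraNT jJ; apply: uJ.
  by rewrite mulr0.
rewrite (big_enum_val (fun j => D (hI k) j * u j 0)) /=.
rewrite (reindex (cast_ord eIJ)) /=; last first.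
  by apply: onW_bij; exists (cast_ord (esym eIJ));
     [apply: cast_ordK | apply: cast_ordKV].
by apply: eq_bigr => l _; rewrite !mxE.
Qed.

(** Multiplying by the adjugate gives [\det M] times [w] equal to [0], with no inverse needed over
    the integers. *)
Lemma det_neq0_inj : \det M != 0 -> forall w : 'cV_#|I|, M *m w = 0 -> w = 0.
Proof.
move=> M0 w /(congr1 (mulmx (\adj M))).
rewrite mulmxA mul_adj_mx mulmx0 mul_scalar_mx => /matrixP Mw.
apply/matrixP => k o; have /eqP := Mw k o; rewrite !mxE mulf_eq0 (negPf M0).
by move/eqP.
Qed.

Lemma minor_neq0_inj : minor I J D != 0 ->
  forall u, supported J u -> D *m u = 0 -> u = 0.
Proof.
rewrite minor_det => M0 u uJ Du; apply: rowsub_hJ_eq0 => //.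
apply: det_neq0_inj => //; rewrite -rowsub_hI_mul // Du.
by apply/matrixP => k o; rewrite !mxE.
Qed.

(* The rows in [I] span the row space of [D], so that a vector of [im D = ker A]
   is determined by its entries in [I]. *)
Lemma minor_neq0_cycle : #|I| = rank_rat D -> minor I J D != 0 ->
  forall v, A *m v = 0 -> supported (~: I)%SET v -> v = 0.
Proof.
move=> rI M0 v /exactAD[u ->] /supported_notin Du.
pose f := @map_mx int rat intr.
have sub : (f _ _ D <= f _ _ (rowsub hI D))%MS.
  rewrite -(geq_leqif (mxrank_leqif_sup _)); last first.
    rewrite /f map_mxsub; apply/row_subP => k; rewrite row_rowsub.
    exact: row_sub.
  rewrite -[X in (X <= _)%N]rI.
  have : minor I J (f _ _ D) != 0 by rewrite minor_map intr_eq0.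
  rewrite (minorE _ eIJ) -unitfE -unitmxE => /mxrank_unit rk.
  rewrite -[X in (X <= _)%N]rk /f map_mxsub.
  have -> : mxsub (@enum_val _ (mem I)) (fun k => enum_val (cast_ord eIJ k))
      (map_mx intr D) =
     mxsub id hJ (mxsub hI id (map_mx (intr : int -> rat) D)).
    by apply/matrixP => a b; rewrite !mxE.
  exact: mxrank_mxsub.
apply: map_intr_mx_eq0; rewrite map_mxM.
have /submxP[Q] := sub; rewrite /f => ->.
by rewrite -mulmxA -map_mxM mul_rowsub_mx Du map_mx0 mulmx0.
Qed.

(** A kernel vector of [M] extends by zero to some [u] supported on [J]. Then [D u] is a cycle
    vanishing on [I], hence zero by the second hypothesis, and [u] is zero by the first. *)
Lemma inj_minor_neq0 :
    (forall u, supported J u -> D *m u = 0 -> u = 0) ->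
    (forall v, A *m v = 0 -> supported (~: I)%SET v -> v = 0) ->
  minor I J D != 0.
Proof.
move=> inj off; rewrite minor_det -det_tr; apply/negP => /det0P[w w0 wM].
have [u uJ uw] := rowsub_hJ_ext w^T.
have Mu : rowsub hI (D *m u) = 0.
  rewrite rowsub_hI_mul // uw; apply: trmx_inj.
  by rewrite trmx_mul trmxK wM trmx0.
have u0 : u = 0.
  apply: inj => //; apply: off; last exact/supported_notin.
  by rewrite mulmxA AD0 mul0mx.
case/eqP: w0; apply: trmx_inj; rewrite -uw u0.
by apply/matrixP => k o; rewrite !mxE.
Qed.

(** With [f] the projection to the coordinates [I], [L = f(ker A)] and [B = M Z^I], the minor is up
    to sign [[Z^I : L] [L : B]]; the numbers [a] and [b] are these two indices. *)
Lemma index_minor : minor I J D != 0 ->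
    (forall v, A *m v = 0 -> supported (~: I)%SET v -> v = 0) ->
  exists a b : nat,
    [/\ cosets [set v : 'cV_n | A *m v = 0] [set D *m u | u in supported J]
          #= `I_b,
        cosets (range (fun v : 'cV_n => A *m v))
               [set A *m v | v in supported (~: I)%SET] #= `I_a &
        (a * b = `|minor I J D|)%N].
Proof.
rewrite minor_det => M0 off.
pose f : {additive 'cV[int]_n -> 'cV[int]_#|I|} := rowsub hI.
pose Z := [set v : 'cV[int]_n | A *m v = 0].
pose DJ := [set D *m u | u in supported J].
pose L := f @` Z; pose B := f @` DJ.
have sZ : subgroup Z.
  split; first exact: mulmx0.
  by move=> x y Zx Zy; rewrite /Z /= mulmxBr Zx Zy subrr.
have sDJ : subgroup DJ by rewrite /DJ image_supported; apply: subgroup_range.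
have sL : subgroup L by apply: subgroup_image.
have sB : subgroup B by apply: subgroup_image.
have DJZ : DJ `<=` Z.
  by move=> _ [u _ <-]; rewrite /Z /= mulmxA AD0 mul0mx.
have BL : B `<=` L by apply: image_subset.
have sT (V : zmodType) : subgroup [set: V] by [].
have kerf v : Z v -> f v = 0 -> DJ v.
  move=> Zv /supported_notin vI; rewrite (off v Zv vI); exact: sDJ.1.
have BE : B = range (fun w : 'cV_#|I| => M *m w).
  apply/seteqP; split=> [_ [_ [u uJ <-] <-]|_ [w _ <-]].
    by exists (rowsub hJ u) => //; rewrite -rowsub_hI_mul.
  have [u uJ <-] := rowsub_hJ_ext w.
  by exists (D *m u); [exists u | rewrite /f /= rowsub_hI_mul].
have [K [x0 [x0T cK]]] := transversal_det M0.
rewrite -BE in x0T.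
have cTB := card_cosets sB x0T.
have fTB : finite_set (cosets setT B) by apply/finite_setP; eexists; exact: cTB.
have [a [x xT]] := exists_transversal sL (finite_cosets_quo sL sB BL fTB).
have [b [y yT]] := exists_transversal sB (finite_cosets_sub (@subsetT _ L) fTB).
exists a, b; split.
(* By [off], [f] is injective on [ker A], so representatives of [L / B] lift to representatives of
   [ker A] modulo [D Z^J]. *)
- have [y' y'T] := transversal_lift sZ sDJ DJZ kerf yT.
  by have := card_cosets sDJ y'T; rewrite card_ord.
(* Representatives of [Z^I / L] are lifted along [f] to [Z^n / B0], then pushed along [A], whose
   kernel is contained in [B0]. *)
- pose B0 := f @^-1` L.
  have sB0 : subgroup B0.
    split; first by rewrite /B0 /= raddf0; apply: sL.1.
    by move=> u v Bu Bv; rewrite /B0 /= raddfB; apply: sL.2.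
  have fsurj w : exists v, f v = w.
    exists (incl_mx I *m w); exact: rowsub_incl_mx.
  have fT : f @` setT = setT.
    by apply/seteqP; split=> // w _; have [v <-] := fsurj w; exists v.
  have fB0 : f @` B0 = L.
    apply/seteqP; split=> [_ [v Bv <-] //|w Lw].
    by have [v vw] := fsurj w; exists v => //; rewrite /B0 /= vw.
  have kerf0 v : setT v -> f v = 0 -> B0 v.
    by move=> _ v0; rewrite /B0 /= v0; apply: sL.1.
  rewrite -fT -fB0 in xT.
  have [x' x'T] := transversal_lift (sT _) sB0 (@subsetT _ B0) kerf0 xT.
  pose g : {additive 'cV[int]_n -> 'cV[int]_p} := mulmx A.
  have kerg v : setT v -> g v = 0 -> B0 v by move=> _ Av; exists v.
  have gT := transversal_image (sT _) sB0 (@subsetT _ B0) kerg x'T.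
  (* A vector [v] of [B0] agrees on [I] with a cycle [z]; the difference [v - z] is supported off
     [I] and has the same image under [A]. *)
  have gB0 : g @` B0 = [set A *m v | v in supported (~: I)%SET].
    apply/seteqP; split=> [_ [v [z Zz fz] <-]|_ [v /supported_notin fv <-]].
      exists (v - z); last by rewrite mulmxBr Zz subr0.
      apply/supported_notin.
      have -> : rowsub hI (v - z) = f (v - z) by [].
      by rewrite raddfB fz subrr.
    exists v => //; rewrite /B0 /=.
    have -> : f v = 0 by [].
    exact: sL.1.
  have := card_cosets (subgroup_image g sB0) gT.
  by rewrite card_ord gB0.
- have := card_cosets sB (transversal_tower (sT _) sL BL (@subsetT _ L) xT yT).
  rewrite card_prod !card_ord card_eq_sym => cab.
  by rewrite -cK; apply/card_eq_II/(card_eq_trans cab).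
Qed.

End Minor.
End Exact.

(** * Trees of a finite CW-complex *)

Lemma rank_dom_int p q (M : 'M[int]_(p, q)) : rank_dom M = rank_rat M.
Proof.
apply/eqP; rewrite eqn_leq; apply/andP; split; apply: mxrank_map_le => a /eqP.
  by rewrite intr_eq0 => /eqP.
by rewrite tofrac_eq0 => /eqP.
Qed.

Section Trees.
Variables (R : realType) (S : finCW R) (C : cellular_chains S).

(** The boundary of a cell of dimension at most [j] lies in open cells of dimension at most [j - 1],
    all of which belong to [T]. *)
Lemma subcomplex_between (j : int) (T : {set acell S}) :
  skeleton S (j - 1) \subset T -> T \subset skeleton S j -> subcomplex T.
Proof.
move=> /fintype.subsetP sT /fintype.subsetP Ts c cT.
have := Ts _ cT; rewrite inE /= => cj; split.
  (* The cell [c] has nonnegative dimension, so [j] is nonnegative and the empty cell lies in the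
     [(j - 1)]-skeleton. *)
  apply: sT; rewrite inE /= lerBrDr addNr.
  exact: le_trans cj.
move=> _ [x dx <-]; have := dx; rewrite /disc /= le_eqVlt => /orP[/eqP sx|ox].
  have [b bc ob] := @cw_attach R S c x sx; exists b => //=.
  apply: sT; rewrite inE /= lerBrDr; apply: le_trans cj.
  by rewrite lezD1 ltz_nat.
by exists c => //; exists x.
Qed.

Definition cellset (j : int) (T : {set acell S}) : {set 'I_#|cells S j|} :=
  [set a | enum_val a \in T]%SET.

Lemma chainsE T j : chains T j = supported (cellset j T).
Proof.
by apply/seteqP; split=> z zT a /zT; rewrite inE.
Qed.

Lemma card_cellset j T : #|T :&: cells S j| = #|cellset j T|.
Proof.
rewrite -(card_imset _ (@enum_val_inj _ (mem (cells S j)))).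
apply: eq_card => c; rewrite inE; apply/andP/imsetP.
  move=> [cT cj]; exists (enum_rank_in cj c); last by rewrite enum_rankK_in.
  by rewrite inE enum_rankK_in.
by move=> [a]; rewrite inE => aT ->; rewrite aT enum_valP.
Qed.

Lemma adim_enum_val j (a : 'I_#|cells S j|) : adim (enum_val a) = j.
Proof. by have := enum_valP a; rewrite inE => /eqP. Qed.

Lemma cellset_skeleton (k j : int) (T : {set acell S}) :
  skeleton S j \subset T -> k <= j -> cellset k T = [set: 'I_#|cells S k|]%SET.
Proof.
move=> /fintype.subsetP sT kj; apply/setP => a; rewrite !inE; apply: sT.
by rewrite inE adim_enum_val.
Qed.

Lemma cellset_above (k j : int) (T : {set acell S}) :
  T \subset skeleton S j -> j < k -> cellset k T = finset.set0.
Proof.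
move=> /fintype.subsetP Ts jk; apply/setP => a; rewrite !inE.
apply: contraTF jk => /Ts; rewrite inE adim_enum_val => kj.
by rewrite -leNgt.
Qed.

Lemma supported_setT m : supported [set: 'I_m]%SET = setT.
Proof. by apply/seteqP; split=> // u _ j; rewrite inE. Qed.

Lemma supported_set0 m : supported (finset.set0 : {set 'I_m}) = [set 0].
Proof.
apply/seteqP; split=> [u u0|_ ->]; last by move=> j; rewrite mxE eqxx.
apply/matrixP => j o; rewrite ord1 mxE; apply/eqP; apply: contraT => /u0.
by rewrite inE.
Qed.

(* The indices [j] and [j - 1 + 1] are provably but not definitionally equal,
   so the matrices they index have distinct types. *)
Lemma boundaries_pred T (j : int) :
  boundaries C T (j - 1) =
  [set boundary_mx C (j - 1) j *m u | u in supported (cellset j T)].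
Proof.
rewrite /boundaries -chainsE.
have : j - 1 + 1 = j by rewrite subrK.
by move: (j - 1 + 1) => l ->.
Qed.

Lemma boundary_boundary_pred (j : int) :
  boundary_mx C (j - 1 - 1) (j - 1) *m boundary_mx C (j - 1) j = 0.
Proof.
have := incidence_boundary C (j - 1); rewrite -/(boundary_mx C _ _).
have : j - 1 + 1 = j by rewrite subrK.
by move: (j - 1 + 1) => l ->.
Qed.

Definition exact_at (j : int) : Prop :=
  forall v : 'cV_#|cells S j|, boundary_mx C (j - 1) j *m v = 0 ->
  exists u, v = boundary_mx C j (j + 1) *m u.

Lemma exact_pred (j : int) : exact_at (j - 1) ->
  forall v : 'cV_#|cells S (j - 1)|,
    boundary_mx C (j - 1 - 1) (j - 1) *m v = 0 ->
  exists u, v = boundary_mx C (j - 1) j *m u.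
Proof.
rewrite /exact_at; have : j - 1 + 1 = j by rewrite subrK.
by move: (j - 1 + 1) => l ->.
Qed.

Lemma homologyE T j : homology C T j = cosets (cycles C T j) (boundaries C T j).
Proof. by []. Qed.

Lemma subgroup_boundaries T j : subgroup (boundaries C T j).
Proof.
rewrite /boundaries chainsE image_supported; exact: subgroup_range.
Qed.

Lemma homology0P T j :
  homology0 C T j <-> (forall z, cycles C T j z -> boundaries C T j z).
Proof.
have sB := subgroup_boundaries T j.
have B0 : [set 0 + w | w in boundaries C T j] = boundaries C T j.
  apply/seteqP; split=> [_ [w Bw <-]|w Bw]; first by rewrite add0r.
  by exists w; rewrite ?add0r.
rewrite /homology0; split=> [h0 z Zz|h].
  have : homology C T j [set z + w | w in boundaries C T j] by exists z.
  rewrite h0 /= -[in RHS]B0 => /(eq_coset _ _ sB).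
  by rewrite subr0.
apply/seteqP; split=> [_ [z /h Bz <-]|_ ->].
  by rewrite /= -[in RHS]B0; apply/(eq_coset _ _ sB); rewrite subr0.
exists 0; last exact: B0.
by split; [move=> a; rewrite mxE eqxx | rewrite mulmx0].
Qed.

Lemma acyclic_exact j : homology0 C [set: acell S]%SET j -> exact_at j.
Proof.
move=> /homology0P h v bv; have [|u _ <-] := h v; last by exists u.
by split=> // a _; rewrite inE.
Qed.

Lemma homology_pred (T : {set acell S}) (j : int) :
    skeleton S (j - 1) \subset T ->
  homology C T (j - 1) =
  cosets [set v | boundary_mx C (j - 1 - 1) (j - 1) *m v = 0]
    [set boundary_mx C (j - 1) j *m u | u in supported (cellset j T)].
Proof.
move=> sT; rewrite homologyE boundaries_pred; congr cosets.
apply/seteqP; split=> [v [] //|v Av]; split=> //.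
by rewrite chainsE (cellset_skeleton sT) // supported_setT.
Qed.

(** Without [(j + 1)]-cells in [T] the boundaries in degree [j] are zero, so the homology is the
    group of cycles itself. *)
Lemma homology0_top (T : {set acell S}) (j : int) : T \subset skeleton S j ->
  homology0 C T j <->
  (forall u, supported (cellset j T) u -> boundary_mx C (j - 1) j *m u = 0 ->
     u = 0).
Proof.
move=> Ts; have -> : homology0 C T j <-> forall z, cycles C T j z -> z = 0.
  rewrite homology0P /boundaries chainsE (cellset_above Ts) ?ltrDl //.
  rewrite supported_set0 image_set1 mulmx0; split=> h z /h //.
by rewrite /cycles chainsE; split=> [h u uT du|h z [zT dz]]; apply: h.
Qed.

(** Let [D_J] be the columns of [D] in [J]. The conditions (i) and (iii) say that [D_J] has rank
    [#|J|] and that [#|J|] is the rank of [D], while (ii) forces [D_J] to have the rank of [D]; any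
    two of them therefore yield (i) and (iii). *)
Lemma is_treeP (T : {set acell S}) (j : int) : exact_at (j - 1) ->
  is_tree C j T <->
  [/\ skeleton S (j - 1) \subset T, T \subset skeleton S j,
      forall u, supported (cellset j T) u ->
        boundary_mx C (j - 1) j *m u = 0 -> u = 0 &
      #|cellset j T| = rank_rat (boundary_mx C (j - 1) j)].
Proof.
move=> /exact_pred ex; rewrite /is_tree rank_dom_int card_cellset /=.
set D := boundary_mx C (j - 1) j; set J := cellset j T.
split=> [[_ sT Ts]|[sT Ts inj cJ]]; last first.
  split=> //; first exact: subcomplex_between Ts.
  by apply: Or32; split=> //; apply/(homology0_top Ts).
have P2 : finite_set (homology C T (j - 1)) ->
    rank_rat (colsub (@enum_val _ (mem J)) D) = rank_rat D.
  rewrite (homology_pred sT) image_supported => fin; apply/eqP.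
  rewrite eqn_leq; apply/andP; split.
    by rewrite /rank_rat map_mxsub; apply: mxrank_mxsub.
  (* The image of [D] consists of cycles, so its cosets are among the homology classes. *)
  apply: finite_cosets_rank; apply: sub_finite_set fin => _ [z [u _ <-] <-].
  by exists (D *m u) => //=; rewrite mulmxA boundary_boundary_pred mul0mx.
have P1 : homology0 C T j <-> rank_rat (colsub (@enum_val _ (mem J)) D) = #|J|.
  exact: iff_trans (homology0_top Ts) (supported_inj _ _).
case=> [[/P1 rJ /P2 rD]|[/P1 rJ P3]|[/P2 rD P3]]; split=> //.
- exact/supported_inj.
- by rewrite -rJ.
- exact/supported_inj.
- by apply/supported_inj; rewrite rD.
Qed.

(** The inverse of [cellset] between sets of [j]-cells and sets of cells lying between the two
    skeleta; it turns sums over trees into sums over column sets. *)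
Definition tree_of (j : int) (J : {set 'I_#|cells S j|}) : {set acell S} :=
  skeleton S (j - 1) :|: [set enum_val a | a in J]%SET.

Lemma cellset_tree_of j J : cellset j (@tree_of j J) = J.
Proof.
apply/setP => a; rewrite !inE adim_enum_val -subr_ge0 addrAC subrr add0r /=.
exact: mem_imset enum_val_inj.
Qed.

Lemma tree_of_cellset j (T : {set acell S}) :
  skeleton S (j - 1) \subset T -> T \subset skeleton S j ->
  tree_of (cellset j T) = T.
Proof.
move=> /fintype.subsetP sT /fintype.subsetP Ts; apply/setP => c.
rewrite finset.in_setU; apply/orP/idP => [[/sT //|/imsetP[a]]|cT].
  by rewrite inE => aT ->.
have := Ts _ cT; rewrite inE le_eqVlt => /orP[cj|cj]; last first.
  by left; rewrite inE lerBrDr lezD1.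
have cJ : c \in cells S j by rewrite inE.
right; apply/imsetP; exists (enum_rank_in cJ c); last by rewrite enum_rankK_in.
by rewrite inE enum_rankK_in.
Qed.

Lemma tree_of_sub j J : skeleton S (j - 1) \subset @tree_of j J.
Proof. exact: finset.subsetUl. Qed.

Lemma sub_tree_of j J : @tree_of j J \subset skeleton S j.
Proof.
apply/fintype.subsetP => c; rewrite finset.in_setU => /orP[|/imsetP[a _ ->]].
  by rewrite !inE => /le_trans; apply; rewrite gerBl.
by rewrite inE adim_enum_val.
Qed.

(** These are the sets of columns forming a basis of the rational column space of the boundary
    matrix. *)
Definition tree_set j (J : {set 'I_#|cells S j|}) : Prop :=
  (forall u, supported J u -> boundary_mx C (j - 1) j *m u = 0 -> u = 0) /\
  #|J| = rank_rat (boundary_mx C (j - 1) j).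

Lemma is_tree_of j J : exact_at (j - 1) ->
  is_tree C j (tree_of J) <-> @tree_set j J.
Proof.
move=> ex; rewrite is_treeP // cellset_tree_of; split=> [[]|[]] //.
by split=> //; [apply: tree_of_sub | apply: sub_tree_of].
Qed.

Lemma wtree_enumE j (A : comNzRingType) (w : 'rV[A]_#|cells S j|) :
    exact_at (j - 1) ->
  wtree_enum C j w = \sum_(J : {set 'I_#|cells S j|} | `[< @tree_set j J >])
    (\prod_(a in J) w 0 a) *
      (homology_card C (tree_of J) (j - 1)%R ^ 2)%N%:R.
Proof.
move=> ex; rewrite /wtree_enum.
rewrite (reindex_onto (@tree_of j) (cellset j)) /=; last first.
  move=> T /asboolP/(is_treeP _ ex)[sT Ts _ _]; exact: tree_of_cellset.
apply: eq_big => [J|J _].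
  rewrite cellset_tree_of eqxx andbT.
  by apply/asboolP/asboolP => /(is_tree_of _ ex).
rewrite (eq_bigl (fun a => a \in J)) // => a.
by rewrite -[in RHS](cellset_tree_of J) [RHS]inE.
Qed.

End Trees.

(** The hypothesis keeps nonzero the principal minors that witness the rank, so the matrix has the
    rank of [D]. This fixes the size of the principal minors in [pdet], and each is expanded by
    Cauchy-Binet. *)
Lemma pdet_weighted_gram (A : idomainType) n m (D : 'M[int]_(n, m))
    (s : 'rV[A]_n) (y : 'rV[A]_m) (D' : 'M[A]_(n, m) := map_mx intr D) :
    (forall I : {set 'I_n}, (exists J, minor I J D != 0) ->
       (\prod_(i in I) s 0 i ^+ 2) *
         (\sum_(J : {set 'I_m} | #|J| == #|I|)
           (\prod_(j in J) y 0 j) * (minor I J D ^+ 2)%:~R) != 0) ->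
  pdet (diag_mx s *m D' *m diag_mx y *m D'^T *m diag_mx s) =
  \sum_(I : {set 'I_n} | #|I| == rank_rat D)
    \sum_(J : {set 'I_m} | #|J| == rank_rat D)
      (\prod_(i in I) s 0 i ^+ 2) * (\prod_(j in J) y 0 j) *
      (minor I J D ^+ 2)%:~R.
Proof.
move=> nz; set L := diag_mx s *m _ *m _ *m _ *m _.
have detE (I : {set 'I_n}) :
  \det (mxsub (@enum_val _ (mem I)) (@enum_val _ (mem I)) L) =
  (\prod_(i in I) s 0 i ^+ 2) * (\sum_(J : {set 'I_m} | #|J| == #|I|)
     (\prod_(j in J) y 0 j) * (minor I J D ^+ 2)%:~R).
  rewrite det_weighted_gram; congr (_ * _); apply: eq_bigr => J _.
  by rewrite minor_map rmorphXn.
have rL : rank_dom L = rank_rat D.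
  apply/eqP; rewrite eqn_leq; apply/andP; split.
    rewrite /rank_dom /L !map_mxM; apply: leq_trans (mxrankM_maxl _ _) _.
    apply: leq_trans (mxrankM_maxl _ _) _.
    apply: leq_trans (mxrankM_maxl _ _) _.
    apply: leq_trans (mxrankM_maxr _ _) _; rewrite -map_mx_comp.
    (* Only an inequality holds for [D'] in general: the integers need not embed in [A]. *)
    apply: (@mxrank_map_le _ _ _ (@FracField.tofrac A \o intr)) => a /eqP.
    by rewrite intr_eq0 => /eqP.
  (* For the lower bound, the rows [I] of a nonzero minor of [D] of maximal size index an invertible
     principal submatrix of [L] over the fraction field. *)
  have [I [J [rI _]]] := exists_minor_neq0 (map_mx (intr : int -> rat) D).
  rewrite minor_map intr_eq0 => m0.
  have := nz I (ex_intro _ J m0); rewrite -detE => d0.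
  rewrite [X in (X <= _)%N](esym rI).
  have u : mxsub (@enum_val _ (mem I)) (@enum_val _ (mem I))
      (map_mx (@FracField.tofrac A) L) \in unitmx.
    by rewrite -map_mxsub unitmxE unitfE det_map_mx tofrac_eq0.
  rewrite -[X in (X <= _)%N](mxrank_unit u); exact: mxrank_mxsub.
rewrite /pdet rL; apply: eq_bigr => I /eqP rI; rewrite detE rI mulr_sumr.
by apply: eq_bigr => J _; rewrite mulrA.
Qed.

(** * Pairs of trees and nonzero minors *)

Section TreeProduct.
Variables (R : realType) (S : finCW R) (C : cellular_chains S) (i : int).
Hypotheses (ex1 : exact_at C (i - 1)) (ex2 : exact_at C (i - 1 - 1)).

Let A := boundary_mx C (i - 1 - 1) (i - 1).
Let D := boundary_mx C (i - 1) i.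

(** The ranks of [A] and [D] add up to the number of [(i-1)]-cells, so [I] has the size of a row
    basis of [D] exactly when its complement has the size of a column basis of [A]. *)
Lemma tree_pairP (I : {set 'I_#|cells S (i - 1)|}) (J : {set 'I_#|cells S i|}) :
  tree_set C (~: I)%SET /\ tree_set C J <->
  [/\ #|I| = rank_rat D, #|J| = rank_rat D & minor I J D != 0].
Proof.
have AD0 : A *m D = 0 by apply: boundary_boundary_pred.
have exAD := exact_pred ex1.
have rAD := rank_exact AD0 exAD.
have cI : (#|I| = rank_rat D) <-> (#|(~: I)%SET| = rank_rat A).
  have := cardsC I; rewrite card_ord => e.
  split=> cI; apply/eqP.
    by rewrite -(eqn_add2l #|I|) e cI addnC rAD.
  by rewrite -(eqn_add2r #|(~: I)%SET|) e cI addnC rAD.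
split=> [[[injA /cI rI] [injD rJ]]|[rI rJ m0]].
  split=> //; apply: (inj_minor_neq0 AD0) => //; first by rewrite rI rJ.
  by move=> v Av vI; apply: injA.
have eIJ : #|I| = #|J| by rewrite rI rJ.
split; split=> //.
- by move=> v vI Av; apply: (minor_neq0_cycle exAD eIJ rI m0).
- exact/cI.
- exact: minor_neq0_inj eIJ m0.
Qed.

Lemma homology_card_minor (I : {set 'I_#|cells S (i - 1)|})
    (J : {set 'I_#|cells S i|}) :
    tree_set C (~: I)%SET -> tree_set C J ->
  (homology_card C (tree_of (~: I)%SET) (i - 1 - 1)%R *
   homology_card C (tree_of J) (i - 1)%R = `|minor I J D|)%N.
Proof.
move=> tI tJ; have [rI rJ m0] := (tree_pairP I J).1 (conj tI tJ).
have AD0 : A *m D = 0 by apply: boundary_boundary_pred.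
have off v : A *m v = 0 -> supported (~: I)%SET v -> v = 0.
  by move=> Av vI; apply: tI.1.
have [a [b [cb ca <-]]] := index_minor AD0
  (etrans rI (esym rJ)) m0 off.
rewrite /homology_card !homology_pred ?tree_of_sub // !cellset_tree_of.
congr (_ * _)%N; last exact: card_fset_set.
(* By exactness one degree lower ([ex2]), the cycles in degree [i - 2] are the image of [A]. *)
rewrite (_ : [set v | _] = range (fun v => A *m v)); first exact: card_fset_set.
apply/seteqP; split=> [z /(exact_pred ex2)[v ->]|_ [v _ <-]]; first by exists v.
by rewrite /= mulmxA boundary_boundary_pred mul0mx.
Qed.

(** The [(i-1)]-trees are reindexed by the complements [I] of their sets of [(i-1)]-cells. Pairs of
    the right sizes that are not pairs of trees have zero minor and may be added to the sum. *)
Lemma wtree_enum_mul (K : comNzRingType) (w : 'rV[K]_#|cells S (i - 1)|)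
    (y : 'rV[K]_#|cells S i|) :
  wtree_enum C (i - 1) w * wtree_enum C i y =
  \sum_(I : {set 'I_#|cells S (i - 1)|} | #|I| == rank_rat D)
    \sum_(J : {set 'I_#|cells S i|} | #|J| == rank_rat D)
      (\prod_(a in (~: I)%SET) w 0 a) * (\prod_(a in J) y 0 a) *
      (minor I J D ^+ 2)%:~R.
Proof.
rewrite !wtree_enumE // big_distrlr /= (reindex_inj (@finset.setC_inj _)) /=.
rewrite !pair_big /= big_mkcond [RHS]big_mkcond /=.
apply: eq_bigr => -[I J] _ /=.
case: asboolP => [tI|ntI]; last first.
  case: eqP => //= rI; case: eqP => //= rJ.
  case: (eqVneq (minor I J D) 0) => [->|m0]; first by rewrite expr0n mulr0.
  by case: ntI; case: ((tree_pairP I J).2 (And3 rI rJ m0)).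
case: asboolP => [tJ|ntJ] /=; last first.
  case: eqP => //= rI; case: eqP => //= rJ.
  case: (eqVneq (minor I J D) 0) => [->|m0]; first by rewrite expr0n mulr0.
  by case: ntJ; case: ((tree_pairP I J).2 (And3 rI rJ m0)).
have [rI rJ _] := (tree_pairP I J).1 (conj tI tJ).
rewrite rI rJ !eqxx /= mulrACA; congr (_ * _).
rewrite -natrM -expnMn homology_card_minor // pmulrn; congr (_ %:~R).
by rewrite -natz natrX natz abszE real_normK ?num_real.
Qed.

End TreeProduct.

Lemma tree_enumE (R : realType) (S : finCW R) (C : cellular_chains S)
    (j : int) :
  (tree_enum C j)%:Z = wtree_enum C j (const_mx 1).
Proof.
rewrite /tree_enum /wtree_enum -natz natr_sum; apply: eq_bigr => T _.
by rewrite big1 ?mul1r // => a _; rewrite mxE.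
Qed.

Theorem theorem5p3 (R : realType) (S : finCW R) (C : cellular_chains S)
    (i : nat) (Sacyclic : acyclic C (i%:Z - 1)) :
  let n := #|cells S (i%:Z - 1)| in
  let m := #|cells S i%:Z| in
  let D : 'M[int]_(n, m) := boundary_mx C (i%:Z - 1) i%:Z in
  pdet (D *m D^T) = (tree_enum C (i%:Z - 1)%R * tree_enum C i%:Z)%N%:Z /\
  forall (F : fieldType) (iota : {rmorphism ratfun (n + m) -> F})
         (sqrtx : 'rV[F]_n),
    let x : 'rV[F]_n := \row_j iota (indet (lshift m j)) in
    let y : 'rV[F]_m := \row_j iota (indet (rshift n j)) in
    (forall j, sqrtx 0 j ^+ 2 = x 0 j) ->
    let D' : 'M[F]_(n, m) := map_mx intr D in
    let L := diag_mx sqrtx *m D' *m diag_mx y *m D'^T *m diag_mx sqrtx in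
    pdet L = (\prod_j x 0 j) *
             wtree_enum C (i%:Z - 1) (\row_j (x 0 j)^-1) *
             wtree_enum C i%:Z y.
Proof.
move=> n m D.
have ex1 : exact_at C (i%:Z - 1).
  by apply: acyclic_exact; apply: Sacyclic; rewrite lexx andbT lerBrDr addNr.
have ex2 : exact_at C (i%:Z - 1 - 1).
  case: i @n @m @D Sacyclic ex1 => [|i'] n m D Sacyclic _.
    (* For [i = 0] the degree is [-2], where there are no cells, the empty cell having dimension
       [-1]. *)
    move=> v _; exists 0; apply/matrixP => a; have := adim_enum_val a.
    by case: (enum_val a).
  apply: acyclic_exact; apply: Sacyclic.
  by rewrite gerBl // andbT -addn1 PoszD addrK lerBrDr addNr.
(* A sum of integer squares with a nonzero term is positive; this is the nonvanishing required by
   [pdet_weighted_gram], at unit weights or after evaluation at the all-ones point. *)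
have sqsum_neq0 (I : {set 'I_n}) : (exists J, minor I J D != 0) ->
    \sum_(J : {set 'I_m} | #|J| == #|I|) minor I J D ^+ 2 != 0.
  move=> [J m0]; rewrite psumr_neq0; last by move=> *; apply: sqr_ge0.
  apply/hasP; exists J; first by rewrite mem_index_enum.
  rewrite exprn_even_gt0 // m0 /= andbT eq_sym.
  by move: m0; rewrite /minor; case: eqP => // _; rewrite eqxx.
split.
  (* The unweighted formula is the case of all weights equal to [1] over the integers. *)
  have /= := @pdet_weighted_gram int n m D (const_mx 1) (const_mx 1).
  rewrite (_ : map_mx intr D = D); last first.
    by apply/matrixP => a b; rewrite mxE intz.
  rewrite !diag_const_mx !mul1mx !mulmx1 => ->; last first.
    move=> I /sqsum_neq0; congr (_ != 0).
    rewrite [X in X * _]big1 ?mul1r => [|a _]; last by rewrite mxE expr1n.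
    apply: eq_bigr => J _; rewrite big1 ?mul1r ?intz // => a _.
    by rewrite mxE.
  rewrite PoszM !tree_enumE wtree_enum_mul //.
  apply: eq_bigr => I _; apply: eq_bigr => J _; congr (_ * _ * _).
  by rewrite !big1 // => a _; rewrite !mxE ?expr1n.
move=> F iota sqrtx x y sx D' L.
have x0 j : x 0 j != 0 by rewrite mxE; apply: Nonvanishing.iota_indet_neq0.
rewrite pdet_weighted_gram => [|I /sqsum_neq0 nz]; last first.
  under eq_bigr do rewrite sx mxE.
  under [X in _ * X]eq_bigr do under eq_bigr do rewrite mxE.
  exact: Nonvanishing.iota_sum_neq0.
rewrite -mulrA wtree_enum_mul // mulr_sumr; apply: eq_bigr => I _.
rewrite mulr_sumr; apply: eq_bigr => J _; rewrite !mulrA; congr (_ * _ * _).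
under eq_bigr do rewrite sx.
(* The product of all the [x_j] splits over [I] and its complement, and the complementary part
   cancels against the inverse weights of the [(i-1)]-tree. *)
rewrite [in RHS](bigID (mem I)) /= -mulrA [X in _ * X](_ : _ = 1) ?mulr1 //.
under [X in _ * X]eq_bigl do rewrite finset.in_setC.
rewrite -big_split big1 //= => j _; rewrite [X in _ * X]mxE divff //.
Qed.
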